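(* Let $0<p<1$, let $(\alpha,\beta)\in\bar D_{c^*(p)}'$, and let $(x^*(\eta),y^*(\eta))$, $\eta\in\mathbb{R}$, be a global solution to (S) with zero-value $(\alpha,\beta)$. Then $(x^*(\eta),y^*(\eta))\to(0,0)$ as $|\eta|\to\infty$.
   Context: Fix $0<p<1$; $x|x|^{p-1}$ is taken to be $0$ at $x=0$. Problem (S) with zero-value $(\alpha,\beta)\in\mathbb{R}^2$ is $x'=y$, $y'=\frac{1}{1-p}x-x|x|^{p-1}-\frac12\eta y$, $(x(0),y(0))=(\alpha,\beta)$, where $'=d/d\eta$. A global solution is a bounded pair $(x,y)\in C^1(\mathbb{R})\cap L^\infty(\mathbb{R})$ satisfying these equations on $\mathbb{R}$. Define $V(x,y)=\frac12y^2-\frac{1}{2(1-p)}x^2+\frac{1}{1+p}|x|^{1+p}$ on $\mathbb{R}^2$ and $c^*(p)=\frac{(1-p)^{2/(1-p)}}{2(1+p)}$. For $0\le c\le c^*(p)$, $D_c$ denotes the interior of the closed level curve $V=c$ surrounding the origin, i.e. $D_c=\{(x,y): |x|<(1-p)^{1/(1-p)},\ V(x,y)<c\}$; for $c=c^*(p)$ the closed curve is formed by the two level curves joining $(-(1-p)^{1/(1-p)},0)$ to $((1-p)^{1/(1-p)},0)$. Finally $\bar D_{c^*(p)}'=\bar D_{c^*(p)}\setminus\{(\pm(1-p)^{1/(1-p)},0),(0,0)\}$, where $\bar D_{c^*(p)}$ is the closure of $D_{c^*(p)}$. *)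

(* Defs.v *)
From HB Require Import structures.
From mathcomp Require Import all_boot all_order all_algebra.
From mathcomp Require Import all_classical all_reals all_analysis.
Set Implicit Arguments.
Unset Strict Implicit.
Unset Printing Implicit Defensive.
Import Order.TTheory GRing.Theory Num.Theory.
Import numFieldNormedType.Exports.
Local Open Scope classical_set_scope.
Local Open Scope ring_scope.

Definition C1 (R : realType) (f : R -> R) : Prop :=
  (forall t, derivable f t 1) /\ continuous (derive1 f).

(* At u = 0 the product is 0 whatever the value of the power. *)
Definition nonlin (R : realType) (p u : R) : R := u * `|u| `^ (p - 1).

Definition solves_S (R : realType) (p alpha beta : R) (x y : R -> R) : Prop :=
  [/\ forall eta, derive1 x eta = y eta,
      forall eta, derive1 y eta =
        (1 - p)^-1 * x eta - nonlin p (x eta) - 2^-1 * eta * y eta,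
      x 0 = alpha
    & y 0 = beta].

(* For the continuous functions considered here, membership in L^oo is
   boundedness. *)
Definition global_solution (R : realType) (p alpha beta : R) (x y : R -> R)
    : Prop :=
  [/\ C1 x, C1 y, bounded_fun x, bounded_fun y & solves_S p alpha beta x y].

Definition V (R : realType) (p : R) (z : R * R) : R :=
  2^-1 * z.2 ^+ 2 - (2 * (1 - p))^-1 * z.1 ^+ 2
    + (1 + p)^-1 * `|z.1| `^ (1 + p).

Definition kappa (R : realType) (p : R) : R := (1 - p) `^ (1 / (1 - p)).

Definition cstar (R : realType) (p : R) : R :=
  (1 - p) `^ (2 / (1 - p)) / (2 * (1 + p)).

(* A level region of the closed curve V = c only for 0 <= c <= cstar p. *)
Definition D (R : realType) (p c : R) : set (R * R) :=
  [set z | `|z.1| < kappa p /\ V p z < c].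

Definition Dbar' (R : realType) (p : R) : set (R * R) :=
  closure (D p (cstar p)) `\`
    [set z | [\/ z = (kappa p, 0), z = (- kappa p, 0) | z = (0, 0)]].

(* Main.v *)
Require Import Defs.
From HB Require Import structures.
From mathcomp Require Import all_boot all_order all_algebra.
From mathcomp Require Import all_classical all_reals all_analysis.
From mathcomp Require Import ring lra.
Import Order.TTheory GRing.Theory Num.Theory.
Import numFieldNormedType.Exports.
Local Open Scope classical_set_scope.
Local Open Scope ring_scope.

(** Along a trajectory [V' = - t y^2 / 2], so [V] decreases on [0, +oo[; it drops
    strictly below [c*] at once because the trajectory is not an equilibrium,
    and this traps [x] in [|x| < kappa p] and keeps it away from the saddles.
    There, with a bound [M] for [|x|] and [|y|], the function
    [x y / t + x^2 / 4 + M^2 / t + 4 V] has derivative at most [- k V / t] for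
    some [k > 0]. As [1 / t] is not integrable at infinity and [V >= 0], [V]
    must tend to 0, and [V] controls [|x|] and [|y|]. The limit at -oo follows
    by the reflection [(x (- t), - y (- t))]. *)

(** * Powers of the absolute value and the nonlinearity *)

Lemma is_derive_continuous {R : realType} (f : R -> R) (u d : R) :
  is_derive u 1 f d -> {for u, continuous f}.
Proof.
by move=> h; apply/differentiable_continuous/derivable1_diffP; exact: ex_derive.
Qed.

(** Lets the quadratic term of [V] be factored by its [|u|^(1+p)] term. The exponents add up to 2,
    never to 0, so [a = 0] is covered. *)
Lemma powR_onep_onem {R : realType} (p a : R) : 0 <= a ->
  a `^ (1 + p) * a `^ (1 - p) = a ^+ 2.
Proof.
move=> a0; rewrite -powR_mulrn// -powRD; first by congr (_ `^ _); lra.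
by apply/implyP => /eqP; lra.
Qed.

Lemma mulr_nonlin {R : realType} (p u : R) : 0 < p ->
  u * nonlin p u = `|u| `^ (1 + p).
Proof.
move=> p0; rewrite /nonlin mulrA -expr2 -real_normK ?num_real//.
have -> : `|u| `^ (1 + p) = `|u| * `|u| `^ p.
  by rewrite -[X in _ = X * _]powRr1// -powRD//; apply/implyP => /eqP; lra.
by rewrite expr2 -mulrA mulr_powRB1.
Qed.

(* Away from 0 this is the chain rule; at 0 it holds because [p > 0]. *)
Lemma is_derive_norm_powR {R : realType} (p u : R) : 0 < p ->
  is_derive u 1 (fun v : R => `|v| `^ (1 + p)) ((1 + p) * nonlin p u).
Proof.
move=> p0.
have E : 1 + p - 1 = p by lra.
case: (ltgtP u 0) => [u0|u0|->].
- refine (near_eq_is_derive (f := fun v : R => (- v) `^ (1 + p)) _ _).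
    by apply: filterS (lt_nbhsl u0) => v v0; rewrite ltr0_norm.
  have h : is_derive (- u) 1 (fun v : R => v `^ (1 + p))
      ((1 + p) * (- u) `^ (1 + p - 1)).
    by apply: is_derive1_powR; rewrite oppr_gt0.
  have k := is_derive1_comp h (is_deriveNid u 1).
  apply: is_derive_eq k _.
  rewrite E /nonlin ltr0_norm// -(mulr_powRB1 (x := - u)) ?oppr_ge0 1?ltW//.
  ring.
- refine (near_eq_is_derive (f := fun v : R => v `^ (1 + p)) _ _).
    by apply: filterS (lt_nbhsr u0) => v v0; rewrite gtr0_norm.
  have h := is_derive1_powR (1 + p) u0.
  by apply: is_derive_eq h _; rewrite E /nonlin gtr0_norm// mulr_powRB1// ltW.
(* At 0 the difference quotient has absolute value [|h|^p], which tends to 0. *)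
- suff h : h^-1 *: (`|h *: (1 : R) + 0| `^ (1 + p) - `|0 : R| `^ (1 + p))
     @[h --> 0^'] --> (0 : R).
    apply: DeriveDef.
      by apply/cvg_ex; exists 0.
    by rewrite /nonlin mul0r mulr0; exact: cvg_lim h.
  apply/cvgrPdist_lt => e e0.
  near=> h.
  have h0 : h != 0 by near: h; exact: nbhs_dnbhs_neq.
  have nh0 : 0 < `|h| by rewrite normr_gt0.
  rewrite sub0r normrN normr0 powR0 ?subr0; last by lra.
  rewrite /GRing.scale/= mulr1 addr0 normrM normfV (ger0_norm (powR_ge0 _ _)).
  rewrite -mulr_powRB1 ?E//; last by lra.
  rewrite mulKf ?gt_eqF//.
  (* With [e] written as a p-th power, [|h| < e^(1/p)] suffices. *)
  have -> : e = (e `^ p^-1) `^ p.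
    by rewrite -powRrM mulVf ?powRr1 1?ltW// gt_eqF.
  apply: gt0_ltr_powR; rewrite ?nnegrE ?powR_ge0//.
  near: h; apply: dnbhs0_lt; exact: powR_gt0.
Unshelve. all: by end_near. Qed.

Lemma continuous_norm_powR {R : realType} (p : R) : 0 < p ->
  continuous (fun v : R => `|v| `^ (1 + p)).
Proof.
by move=> p0 u; exact: is_derive_continuous (is_derive_norm_powR p u p0).
Qed.

(** * The function [V] on the strip [|u| < kappa p] *)

Lemma continuous_V {R : realType} (p : R) : 0 < p -> continuous (V p).
Proof.
move=> p0 z; rewrite /V.
apply: cvgD.
  apply: cvgB; apply: cvgM; try exact: cvg_cst;
  apply: (continuous_comp (g := fun u : R => u ^+ 2));
    try exact: exprn_continuous.
  - exact: cvg_snd.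
  - exact: cvg_fst.
apply: cvgM; first exact: cvg_cst.
apply: (continuous_comp (g := fun u : R => `|u| `^ (1 + p))).
  exact: cvg_fst.
exact: continuous_norm_powR.
Qed.

Lemma kappa_gt0 {R : realType} (p : R) : p < 1 -> 0 < kappa p.
Proof. by move=> p1; apply: powR_gt0; lra. Qed.

Lemma kappa_powR_onem {R : realType} (p : R) : p < 1 ->
  kappa p `^ (1 - p) = 1 - p.
Proof.
by move=> p1; rewrite /kappa -powRrM mulrVK ?unitfE ?powRr1; lra.
Qed.

(** For nonzero [u] the left side says that [|u|^p] exceeds [|u| / (1 - p)]: within the strip the
    nonlinear restoring force beats the linear repulsion. *)
Lemma powR_onem_lt {R : realType} (p u : R) : p < 1 ->
  (`|u| `^ (1 - p) < 1 - p) = (`|u| < kappa p).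
Proof.
move=> p1; rewrite -[X in _ < X]kappa_powR_onem//.
have k0 : kappa p \is Num.nneg by rewrite nnegrE ltW// kappa_gt0.
have q0 : 0 < 1 - p by lra.
apply/idP/idP => [|h]; last exact: gt0_ltr_powR.
apply: contraTT; rewrite -!leNgt => h.
by apply: ge0_ler_powR => //; exact: ltW.
Qed.

(** The lines [|u| = kappa p] pass through the saddles, where the potential part of [V] is exactly
    c*; hence [V < c*] fails on them. *)
Lemma V_kappa {R : realType} (p u v : R) : 0 < p < 1 -> `|u| = kappa p ->
  V p (u, v) = 2^-1 * v ^+ 2 + cstar p.
Proof.
move=> /andP[p0 p1] uk; rewrite /V/= -[u ^+ 2]real_normK ?num_real// uk.
have E : cstar p = kappa p ^+ 2 / (2 * (1 + p)).
  rewrite /cstar /kappa -powR_mulrn ?powR_ge0// -powRrM.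
  by congr (_ `^ _ / _); ring.
have := powR_onep_onem p (kappa p) (ltW (kappa_gt0 p p1)).
rewrite E kappa_powR_onem// => <-.
field; lra.
Qed.

(** Since [|u|^(1-p) <= 1 - p], the negative quadratic term costs at most [|u|^(1+p) / 2], and
    [1/(1+p) - 1/2 = (1-p)/(2(1+p))] remains. *)
Lemma V_ge {R : realType} (p u v : R) : 0 < p < 1 -> `|u| <= kappa p ->
  2^-1 * v ^+ 2 + (1 - p) / (2 * (1 + p)) * `|u| `^ (1 + p) <= V p (u, v).
Proof.
move=> /andP[p0 p1] uk; rewrite /V/= -[u ^+ 2]real_normK ?num_real//.
rewrite -(powR_onep_onem p `|u|)//.
have : `|u| `^ (1 - p) <= 1 - p.
  rewrite -[leRHS]kappa_powR_onem//; apply: ge0_ler_powR => //.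
  - by lra.
  - by rewrite nnegrE ltW// kappa_gt0.
have := powR_ge0 `|u| (1 + p).
set a := _ `^ (1 + p); set b := _ `^ (1 - p) => a0 b1.
have -> : (2 * (1 - p))^-1 * (a * b) = (2 * (1 - p))^-1 * (a * (1 - p))
   - (2 * (1 - p))^-1 * (a * (1 - p - b)) by ring.
have -> : (2 * (1 - p))^-1 * (a * (1 - p)) = a / 2 by field; lra.
have -> : (1 - p) / (2 * (1 + p)) * a = (1 + p)^-1 * a - a / 2 by field; lra.
have : 0 <= (2 * (1 - p))^-1 * (a * (1 - p - b)).
  by rewrite !mulr_ge0 ?invr_ge0//; lra.
lra.
Qed.

Lemma V_ge0 {R : realType} (p u v : R) : 0 < p < 1 -> `|u| <= kappa p ->
  0 <= V p (u, v).
Proof.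
move=> p01 uk; apply: le_trans (V_ge p u v p01 uk).
have /andP[p0 p1] := p01.
apply: addr_ge0; last by rewrite mulr_ge0 ?powR_ge0 ?divr_ge0//; lra.
by rewrite mulr_ge0 ?sqr_ge0//; lra.
Qed.

(** A level strictly below c* keeps [|u|] under some [r < kappa p], so the restoring force dominates
    by a uniform factor; this factor is [k]. *)
Lemma V_le_dissipation {R : realType} (p c : R) : 0 < p < 1 -> c < cstar p ->
  exists2 k : R, 0 < k & forall u v : R, `|u| < kappa p -> V p (u, v) <= c ->
    k * V p (u, v) <= v ^+ 2 + u * (nonlin p u - (1 - p)^-1 * u).
Proof.
move=> p01 hc; have /andP[p0 p1] := p01.
have k0 := kappa_gt0 p p1.
have cV : V p (u, 0) @[u --> kappa p] --> V p (kappa p, 0).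
  have h : (u, 0 : R) @[u --> kappa p] --> (kappa p, 0 : R).
    by apply: (@cvg_pair _ _ _ (nbhs _) (nbhs (kappa p)) (nbhs (0 : R)));
      [exact: cvg_id|exact: cvg_cst].
  exact: continuous_cvg (continuous_V p p0 _) h.
have Vk : c < V p (kappa p, 0).
  by rewrite V_kappa// ?gtr0_norm// expr0n/= mulr0 add0r.
have /nbhs_ballP[e /= e0 he] : \forall u \near kappa p, c < V p (u, 0).
  exact: cvgr_gt cV _ Vk.
(* The maximum with 0 keeps [r] a nonnegative base for the powers. *)
pose r := Num.max 0 (kappa p - e).
have rk : r < kappa p by rewrite gt_max k0/=; lra.
have r0 : 0 <= r by rewrite le_max lexx.
have hr : r `^ (1 - p) < 1 - p.
  by have := powR_onem_lt p r p1; rewrite ger0_norm// rk.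
pose k := 1 - r `^ (1 - p) / (1 - p).
have kk : 0 < k <= 1.
  rewrite /k subr_gt0 ltr_pdivrMr ?mul1r ?hr/=; last by lra.
  by rewrite gerBl divr_ge0 ?powR_ge0//; lra.
exists k => [|u v uk Vc]; first by lra.
have ur : `|u| <= r.
  rewrite le_max; case: (leP `|u| (kappa p - e)) => ur; rewrite ?orbT//.
  exfalso.
  (* Replacing [(u, v)] by [(|u|, 0)] can only lower [V], so [V p (u, v)] would exceed [c]. *)
  have : c < V p (`|u|, 0).
    apply: he => /=; rewrite /ball/= ger0_norm; lra.
  move: Vc; rewrite /V/= normr_id real_normK ?num_real// expr0n/= mulr0.
  by have := sqr_ge0 v; lra.
have bq : `|u| `^ (1 - p) <= r `^ (1 - p) by apply: ge0_ler_powR => //; lra.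
rewrite mulrBr mulr_nonlin// mulrCA -expr2.
rewrite /V/= -[u ^+ 2]real_normK ?num_real// -(powR_onep_onem p `|u|)//.
have := powR_ge0 `|u| (1 + p).
have := powR_ge0 `|u| (1 - p).
move: bq kk; rewrite /k.
move: (r `^ _) (_ `^ (1 + p)) (_ `^ (1 - p)) (sqr_ge0 v).
move: (v ^+ 2) => w s a b w0 bs + b0 a0.
have i0 : 0 < (1 - p)^-1 by rewrite invr_gt0; lra.
have -> : (2 * (1 - p))^-1 = 2^-1 * (1 - p)^-1 by field; lra.
move: (1 - p)^-1 i0 => i i0 kk.
have j1 : 0 <= (1 + p)^-1 <= 1 by rewrite invr_ge0 invf_le1; lra.
move: (1 + p)^-1 j1 => j j1.
(* Dropping the quadratic term and using [j <= 1] gives [k V <= k (w + a)]; then [k <= 1] handles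
   [w], and [b <= s] turns [k a] into [a - i a b]. *)
have h1 : 0 <= i * (a * b) by rewrite !mulr_ge0// ltW.
have h2 : 0 <= a * (i * (s - b)) by rewrite !mulr_ge0//; lra.
have h3 : (1 - s * i) * (2^-1 * w - 2^-1 * i * (a * b) + j * a)
    <= (1 - s * i) * (w + a).
  apply: ler_wpM2l; first lra.
  have : 0 <= (1 - j) * a by rewrite mulr_ge0//; lra.
  by lra.
have h4 : 0 <= (1 - (1 - s * i)) * w by rewrite mulr_ge0//; lra.
nra.
Qed.

(** Weak inequalities survive the closure; if [|alpha| = kappa p], then [V <= c*] forces [beta = 0],
    which is an excluded saddle. *)
Lemma Dbar'_bounds {R : realType} (p alpha beta : R) : 0 < p < 1 ->
  Dbar' p (alpha, beta) ->
  [/\ `|alpha| < kappa p, V p (alpha, beta) <= cstar p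
    & (alpha, beta) != (0, 0)].
Proof.
move=> p01 [cD nab]; have /andP[p0 p1] := p01.
have ak : `|alpha| <= kappa p.
  have cl : closed [set z : R * R | `|z.1| <= kappa p].
    apply: (@preimage_closed _ _ (fun z : R * R => `|z.1|)
      [set r | r <= kappa p]).
      by move=> z _; apply: cvg_norm; exact: cvg_fst.
    exact: closed_le.
  by apply: (cl (alpha, beta)); apply: closure_subset cD => z [/ltW].
have Vc : V p (alpha, beta) <= cstar p.
  have cl : closed [set z : R * R | V p z <= cstar p].
    apply: (@preimage_closed _ _ (V p) [set r | r <= cstar p]).
      by move=> z _; exact: continuous_V.
    exact: closed_le.
  by apply: (cl (alpha, beta)); apply: closure_subset cD => z [_ /ltW].
split=> //; last by apply/eqP => h; apply: nab; apply: Or33.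
rewrite lt_neqAle ak andbT; apply/negP => /eqP ae; apply: nab.
move: Vc; rewrite V_kappa// => Vc.
have b0 : beta = 0.
  apply/eqP; rewrite -sqrf_eq0 eq_le sqr_ge0 andbT; lra.
rewrite b0; move: ae; case: (ger0P alpha) => _ => [->|<-]; first exact: Or31.
by apply: Or32; rewrite opprK.
Qed.

(** * Decay of [V] along a trajectory and the limit at +oo *)

Lemma le0_is_derive_nonincreasing {R : realType} (f df : R -> R) (a : R) :
  (forall t, a <= t -> is_derive t 1 f (df t)) ->
  (forall t, a <= t -> df t <= 0) ->
  forall s t, a <= s -> s <= t -> f t <= f s.
Proof.
move=> hf hdf; apply: ler0_derive1_nincry => [t|t|].
- by rewrite in_itv/= andbT => /ltW /hf h; exact: ex_derive.
- rewrite in_itv/= andbT => /ltW at_; have h := hf t at_.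
  by rewrite derive1E derive_val; exact: hdf.
- apply: derivable_within_continuous => t.
  by rewrite in_itv/= andbT => /hf h; exact: ex_derive.
Qed.

Section trajectory.
Context {R : realType} (p alpha beta : R) (x y : R -> R).
Hypotheses (p01 : 0 < p < 1) (dx : forall t, derivable x t 1)
  (dy : forall t, derivable y t 1) (hS : solves_S p alpha beta x y).

Let force t := (1 - p)^-1 * x t - nonlin p (x t) - 2^-1 * t * y t.

Lemma is_derive_x (t : R) : is_derive t 1 x (y t).
Proof.
have [hx _ _ _] := hS.
by apply: DeriveDef; [exact: dx|rewrite -derive1E hx].
Qed.

Lemma is_derive_y (t : R) : is_derive t 1 y (force t).
Proof.
have [_ hy _ _] := hS.
by apply: DeriveDef; [exact: dy|rewrite -derive1E hy].
Qed.

Lemma is_derive_V (t : R) :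
  is_derive t 1 (fun s => V p (x s, y s)) (- 2^-1 * t * y t ^+ 2).
Proof.
have /andP[p0 p1] := p01.
have hx := is_derive_x t; have hy := is_derive_y t.
have hw := is_derive1_comp (is_derive_norm_powR p (x t) p0) hx.
have h := is_deriveD (is_deriveB (is_deriveZ 2^-1 (is_deriveX 2 hy))
  (is_deriveZ (2 * (1 - p))^-1 (is_deriveX 2 hx)))
  (is_deriveZ (1 + p)^-1 hw).
apply: is_derive_eq h _.
rewrite /force /GRing.scale/= !expr1.
by field; lra.
Qed.

Lemma V_nonincreasing s t : 0 <= s -> s <= t ->
  V p (x t, y t) <= V p (x s, y s).
Proof.
apply: (le0_is_derive_nonincreasing (fun r => V p (x r, y r))
  (fun r => - 2^-1 * r * y r ^+ 2)) => r r0; first exact: is_derive_V.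
by have : 0 <= r * y r ^+ 2 by [rewrite mulr_ge0 ?sqr_ge0]; lra.
Qed.

(* Staying on the level set V = c* forces y = 0 identically, so the trajectory
   would be an equilibrium. *)
Lemma V_lt_cstar : `|alpha| < kappa p -> V p (alpha, beta) <= cstar p ->
  (alpha, beta) != (0, 0) -> forall t, 0 < t -> V p (x t, y t) < cstar p.
Proof.
move=> ak Vc ab0 t t0; have [hx hy x0 y0] := hS.
have /andP[p0 p1] := p01.
have Vle r : 0 <= r -> V p (x r, y r) <= cstar p.
  move=> r0; apply: le_trans (V_nonincreasing 0 r _ r0) _ => //.
  by rewrite x0 y0.
rewrite lt_neqAle (Vle _ (ltW t0)) andbT; apply/negP => /eqP Vt.
have Veq r : r \in `]0, t[ -> V p (x r, y r) = cstar p.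
  rewrite in_itv/= => /andP[r0 rt]; apply/eqP.
  rewrite eq_le (Vle _ (ltW r0))/= -Vt.
  by apply: V_nonincreasing; exact: ltW.
have y_eq0 r : r \in `]0, t[ -> y r = 0.
  move=> rI.
  have h := is_derive_V r.
  (* [V] is constant on the interval, so each interior point is a maximum; the two values of the
     derivative then give [r y^2 = 0] with [r > 0]. *)
  have h0 : is_derive r 1 (fun s => V p (x s, y s)) 0.
    apply: (derive1_at_max (ltW t0) _ rI) => [s _|s sI].
      by have hs := is_derive_V s; exact: ex_derive.
    by rewrite !Veq.
  have := @derive_val _ _ _ _ _ _ _ h.
  rewrite (@derive_val _ _ _ _ _ _ _ h0).
  move: rI; rewrite in_itv/= => /andP[r0 _] /esym /eqP.
  rewrite mulf_eq0 sqrf_eq0 mulf_eq0 oppr_eq0 invr_eq0 pnatr_eq0 (gt_eqF r0).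
  by move=> /eqP.
pose r := t / 2.
have rI : r \in `]0, t[ by rewrite in_itv/= /r; lra.
have r0 : 0 < r by rewrite /r; lra.
have xr : x r = alpha.
  have [|s sI] := @MVT _ x y 0 r r0 (fun s _ => is_derive_x s).
    by apply: derivable_within_continuous => s _.
  rewrite y_eq0 ?mul0r ?x0; first by move/eqP; rewrite subr_eq0 => /eqP.
  by move: sI; rewrite !in_itv/= /r => /andP[? ?]; lra.
have force0 : force r = 0.
  have h := is_derive_y r.
  have h0 : is_derive r 1 y 0.
    apply: (derive1_at_max (ltW t0) _ rI) => [s _|s sI]; first exact: dy.
    by rewrite !y_eq0.
  have := @derive_val _ _ _ _ _ _ _ h.
  by rewrite (@derive_val _ _ _ _ _ _ _ h0).
(* [alpha] times the vanishing force factors as [|alpha|^(1+p) (|alpha|^(1-p) - (1-p))] up to a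
   constant, and the second factor is negative in the strip. *)
have a0 : alpha = 0.
  have : alpha * force r = 0 by rewrite force0 mulr0.
  rewrite /force y_eq0// xr mulr0 subr0 mulrBr mulr_nonlin// mulrCA -expr2.
  rewrite -[alpha ^+ 2]real_normK ?num_real// -(powR_onep_onem p `|alpha|)//.
  move=> E.
  have : `|alpha| `^ (1 + p) * (`|alpha| `^ (1 - p) - (1 - p)) = 0.
    transitivity ((1 - p) * ((1 - p)^-1 *
      (`|alpha| `^ (1 + p) * `|alpha| `^ (1 - p)) - `|alpha| `^ (1 + p))).
      by field; lra.
    by rewrite E mulr0.
  move/eqP; rewrite mulf_eq0 powR_eq0 normr_eq0 => /orP[/andP[/eqP]//|/eqP].
  by have := powR_onem_lt p alpha p1; rewrite ak; lra.
(* The trajectory would sit at the origin, where [V] is 0 and not c*. *)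
have := Veq r rI; rewrite xr y_eq0// a0 /V/= normr0 powR0 ?expr0n/=; last lra.
have : 0 < cstar p by rewrite divr_gt0 ?powR_gt0//; lra.
by lra.
Qed.

(** To leave the strip, [|x|] would have to equal [kappa p] at some positive time, where [V >= c*]
    by [V_kappa]. *)
Lemma norm_x_lt_kappa : `|alpha| < kappa p ->
  (forall t, 0 < t -> V p (x t, y t) < cstar p) ->
  forall t, 0 <= t -> `|x t| < kappa p.
Proof.
move=> ak hV t t0; have [hx hy x0 y0] := hS.
rewrite ltNge; apply/negP => kx.
have [||s] := @IVT R (fun s => `|x s|) 0 t (kappa p) t0.
- apply: continuous_subspaceT => s; apply: cvg_norm.
  exact: is_derive_continuous (is_derive_x s).
- by rewrite x0 ge_min ltW//= le_max kx orbT.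
rewrite in_itv/= => /andP[]; rewrite le_eqVlt => /predU1P[<-|s0] _ xs.
  by move: xs ak; rewrite x0 => ->; rewrite ltxx.
have := hV s s0; rewrite V_kappa//.
by have := sqr_ge0 (y s); lra.
Qed.

Lemma V_gets_small (M : R) :
  (forall t, `|x t| <= M) -> (forall t, `|y t| <= M) ->
  (forall t, 0 <= t -> `|x t| < kappa p) -> V p (x 1, y 1) < cstar p ->
  forall e, 0 < e -> exists2 t, 1 <= t & V p (x t, y t) < e.
Proof.
move=> xM yM xk V1 e e0; apply: contrapT => /forall2NP hn.
have Ve t : 1 <= t -> e <= V p (x t, y t).
  by move=> t1; rewrite leNgt; apply/negP; have [|] := hn t.
(* The level is [V] at time 1: strictly below c* and an upper bound for [V] afterwards. *)
have [k k0 hk] := V_le_dissipation p _ p01 V1.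
have xyM t : `|x t * y t| <= M ^+ 2 by rewrite normrM expr2 ler_pM.
(* Differentiating [x y / t] yields the dissipation; [x^2 / 4] cancels its [- x y / 2], [M^2 / t]
   absorbs [- x y / t^2], and [4 V] pays for [y^2 / t] when [t >= 1]. If [V >= e], adding [k e ln t]
   keeps [L] nonincreasing. *)
pose L t := x t * y t * t^-1 + 4^-1 * x t ^+ 2 + M ^+ 2 * t^-1
  + 4 * V p (x t, y t) + k * e * ln t.
pose dL t := (y t ^+ 2 + x t * force t) * t^-1 - x t * y t * t^-1 ^+ 2
  + 2^-1 * x t * y t - M ^+ 2 * t^-1 ^+ 2 - 2 * t * y t ^+ 2 + k * e * t^-1.
have hL (t : R) : 1 <= t -> is_derive t 1 L (dL t).
  move=> t1; have t0 : 0 < t by lra.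
  have hx := is_derive_x t; have hy := is_derive_y t; have hV := is_derive_V t.
  have hi : is_derive t 1 (fun s : R => s^-1) (- t ^- 2 *: 1).
    exact: (@is_deriveV R id t 1 1 (lt0r_neq0 t0) (is_derive_id t 1)).
  have h := is_deriveD (is_deriveD (is_deriveD (is_deriveD
     (is_deriveM (is_deriveM hx hy) hi) (is_deriveZ 4^-1 (is_deriveX 2 hx)))
     (is_deriveZ (M ^+ 2) hi)) (is_deriveZ 4 hV))
     (is_deriveZ (k * e) (is_derive1_ln t0)).
  apply: is_derive_eq h _.
  rewrite /dL /GRing.scale/= !expr1 -exprVn.
  have -> : (x * y) t = x t * y t by [].
  by field; lra.
have dL_le0 (t : R) : 1 <= t -> dL t <= 0.
  move=> t1.
  have ti : 0 < t^-1 by rewrite invr_gt0; lra.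
  have h := hk (x t) (y t) (xk t _) (V_nonincreasing 1 t _ t1).
  have {}h : k * e <= y t ^+ 2 + x t * (nonlin p (x t) - (1 - p)^-1 * x t).
    apply: le_trans (h _ _); try lra.
    by rewrite ler_pM2l// Ve.
  have -> : dL t = - (y t ^+ 2 + x t * (nonlin p (x t) - (1 - p)^-1 * x t)
       - k * e) * t^-1 - (x t * y t + M ^+ 2) * t^-1 ^+ 2
       - 2 * y t ^+ 2 * (t - t^-1).
    rewrite /dL /force; have /andP[p0 p1] := p01; field; lra.
  have h1 : 0 <= (y t ^+ 2 + x t * (nonlin p (x t) - (1 - p)^-1 * x t)
       - k * e) * t^-1 by rewrite mulr_ge0 ?(ltW ti)// subr_ge0.
  have h2 : 0 <= (x t * y t + M ^+ 2) * t^-1 ^+ 2.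
    rewrite mulr_ge0 ?sqr_ge0//.
    by have := xyM t; rewrite ler_norml; lra.
  have h3 : 0 <= y t ^+ 2 * (t - t^-1).
    by rewrite mulr_ge0 ?sqr_ge0// subr_ge0 (le_trans _ t1)// invf_le1//; lra.
  lra.
have hdec := le0_is_derive_nonincreasing L dL 1 hL dL_le0.
(* At time [expR c] the logarithmic term alone exceeds [L 1], while the other terms have a
   nonnegative sum. *)
pose c := (`|L 1| + M ^+ 2 + 1) / (k * e).
have ke : 0 < k * e by rewrite mulr_gt0.
have c0 : 0 <= c.
  by rewrite divr_ge0 ?(ltW ke)// !addr_ge0 ?sqr_ge0.
have E1 : 1 <= expR c by rewrite -expR0 ler_expR.
have := hdec 1 (expR c) (lexx _) E1.
rewrite {1}/L expRK.
have -> : k * e * c = `|L 1| + M ^+ 2 + 1 by rewrite /c mulrC divfK// gt_eqF.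
have Vp : 0 <= V p (x (expR c), y (expR c)).
  by apply: V_ge0 => //; apply/ltW/xk; lra.
have : 0 <= (x (expR c) * y (expR c) + M ^+ 2) * (expR c)^-1.
  rewrite mulr_ge0 ?invr_ge0 ?expR_ge0//.
  by have := xyM (expR c); rewrite ler_norml; lra.
have := sqr_ge0 (x (expR c)); have := ler_norm (L 1); have := sqr_ge0 M.
lra.
Qed.

Lemma trajectory_cvg_pinfty (M : R) :
  (forall t, `|x t| <= M) -> (forall t, `|y t| <= M) ->
  `|alpha| < kappa p -> V p (alpha, beta) <= cstar p ->
  (alpha, beta) != (0, 0) ->
  (x t, y t) @[t --> +oo] --> ((0, 0) : R * R).
Proof.
move=> xM yM ak Vc ab0; have /andP[p0 p1] := p01.
have hV := V_lt_cstar ak Vc ab0.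
have xk := norm_x_lt_kappa ak hV.
have small := V_gets_small M xM yM xk (hV 1 ltr01).
suff h e : 0 < e -> \forall t \near +oo, `|x t| < e /\ `|y t| < e.
  apply: (@cvg_pair _ _ _ (pinfty_nbhs R) (nbhs (0 : R)) (nbhs (0 : R)));
    by apply/cvgr0Pnorm_lt => e e0; apply: filterS (h e e0) => t [].
move=> e0.
pose q := (1 - p) / (2 * (1 + p)).
have q0 : 0 < q by rewrite divr_gt0//; lra.
(* If [|x|] or [|y|] reached [e], the matching term of the lower bound [V_ge] would already be at
   least [d]. *)
pose d := Num.min (q * e `^ (1 + p)) (2^-1 * e ^+ 2).
have d0 : 0 < d.
  rewrite lt_min; apply/andP.
  by split; rewrite mulr_gt0 ?powR_gt0 ?exprn_gt0 ?invr_gt0.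
have [T T1 VT] := small d d0.
exists T; split => [|t Tt]; first exact: num_real.
have Vt : V p (x t, y t) < d.
  by apply: le_lt_trans VT; apply: V_nonincreasing; lra.
have := V_ge p (x t) (y t) p01 (ltW (xk t _)); rewrite -/q => Vg.
have {}Vg := Vg ltac:(lra).
have h1 : 0 <= q * `|x t| `^ (1 + p) by rewrite mulr_ge0 ?powR_ge0// ltW.
have h2 := sqr_ge0 (y t).
move: Vt; rewrite lt_min => /andP[Vx Vy].
split; rewrite ltNge; apply/negP => eb.
  have : q * e `^ (1 + p) <= q * `|x t| `^ (1 + p).
    by rewrite ler_pM2l//; apply: ge0_ler_powR; rewrite ?nnegrE//; lra.
  lra.
have : e ^+ 2 <= `|y t| ^+ 2 by rewrite ler_pXn2r// nnegrE ltW.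
rewrite real_normK ?num_real//; lra.
Qed.

End trajectory.

(** * Uniform bounds, time reflection and both limits *)

Lemma bounded_pair_bound {R : realType} (x y : R -> R) :
  bounded_fun x -> bounded_fun y ->
  exists M, (forall t, `|x t| <= M) /\ (forall t, `|y t| <= M).
Proof.
(* Boundedness supplies only the constants strictly above [M1] and [M2], hence the added 1. *)
move=> [M1 [_ h1]] [M2 [_ h2]]; exists (Num.max M1 M2 + 1); split => t.
  apply: h1 => //; rewrite (le_lt_trans (y := Num.max M1 M2)) ?ltrDl//.
  by rewrite le_max lexx.
apply: h2 => //; rewrite (le_lt_trans (y := Num.max M1 M2)) ?ltrDl//.
by rewrite le_max lexx orbT.
Qed.

(** The damping coefficient is odd in time and [y] changes sign under reflection, so their product
    keeps its form. *)
Lemma solves_S_reflect {R : realType} (p alpha beta : R) (x y : R -> R) :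
  (forall t, derivable x t 1) -> (forall t, derivable y t 1) ->
  solves_S p alpha beta x y ->
  let x' t := x (- t) in let y' t := - y (- t) in
  [/\ forall t, derivable x' t 1, forall t, derivable y' t 1
    & solves_S p alpha (- beta) x' y'].
Proof.
move=> dx dy hS x' y'.
have hx' (t : R) : is_derive t 1 x' (- y (- t)).
  have h := is_derive1_comp
    (is_derive_x _ _ _ _ _ dx hS (- t)) (is_deriveNid t 1).
  by apply: is_derive_eq h _; rewrite mulrN1.
have hy' (t : R) : is_derive t 1 y'
    ((1 - p)^-1 * x' t - nonlin p (x' t) - 2^-1 * t * y' t).
  have h := is_deriveN
    (is_derive1_comp (is_derive_y _ _ _ _ _ dy hS (- t)) (is_deriveNid t 1)).
  by apply: is_derive_eq h _; rewrite /x' /y'; ring.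
have [_ _ x0 y0] := hS.
split=> [t|t|]; try exact: ex_derive.
by split=> [t|t||]; rewrite ?derive1E ?derive_val// /x' /y' oppr0 ?x0 ?y0.
Qed.

Theorem theorem7 (R : realType) (p : R) (hp0 : 0 < p) (hp1 : p < 1)
    (alpha beta : R) (hab : Dbar' p (alpha, beta))
    (x y : R -> R) (hxy : global_solution p alpha beta x y) :
  ((x eta, y eta) @[eta --> +oo] --> ((0, 0) : R * R)) /\
  ((x eta, y eta) @[eta --> -oo] --> ((0, 0) : R * R)).
Proof.
have p01 : 0 < p < 1 by rewrite hp0.
have [[dx _] [dy _] bx by_ hS] := hxy.
have [ak Vc ab0] := Dbar'_bounds p alpha beta p01 hab.
have [M [xM yM]] := bounded_pair_bound x y bx by_.
split.
  exact: (trajectory_cvg_pinfty p alpha beta x y p01 dx dy hS M xM yM).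
have [dx' dy' hS'] := solves_S_reflect p alpha beta x y dx dy hS.
have h : (x (- t), - y (- t)) @[t --> +oo] --> ((0, 0) : R * R).
  apply: (trajectory_cvg_pinfty _ _ _ _ _ p01 dx' dy' hS' M _ _ ak).
  - by move=> t; exact: xM.
  - by move=> t; rewrite normrN.
  - by move: Vc; rewrite /V/= sqrrN.
  - by apply: contraNneq ab0 => -[-> /eqP]; rewrite oppr_eq0 => /eqP ->.
(* The limit at -oo becomes one at +oo along [- t], which differs from [h] only by the sign of the
   second component. *)
apply/cvgNy_compNP.
apply: (@cvg_pair _ _ _ (pinfty_nbhs R) (nbhs (0 : R)) (nbhs (0 : R))).
- exact: cvg_comp h cvg_fst.
- have hy : - y (- t) @[t --> +oo] --> (0 : R) by exact: cvg_comp h cvg_snd.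
  apply/cvgr0Pnorm_lt => e e0.
  by move/cvgr0Pnorm_lt : hy => /(_ e e0); apply: filterS => t; rewrite normrN.
Qed.
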